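(* Let $\mathbb{X}$ be an additive symmetric monoidal category with finite biproducts, and equip $\mathsf{Arr}[\mathbb{X}]$ with the symmetric monoidal structure $(\boxtimes,\ 0\colon I\to\mathsf{0})$. Then there is an isomorphism of categories $\mathsf{CMON}\big[\mathsf{Arr}[\mathbb{X}]\big]\cong\mathsf{DER}[\mathbb{X}]$ between the category of commutative monoids in $\mathsf{Arr}[\mathbb{X}]$ and the category of derivations in $\mathbb{X}$.
   Context: Symmetric monoidal categories $(\mathbb{X},\otimes,I)$ are written as strict (associators and unitors treated as identities), with symmetry $\sigma_{A,B}\colon A\otimes B\to B\otimes A$. An additive category is a category enriched over commutative monoids: each hom-set is a commutative monoid $(+,0)$ and composition preserves $+$ and $0$ in each argument (no negatives assumed). An additive symmetric monoidal category is a symmetric monoidal category that is additive and such that $\otimes$ of maps preserves $+$ and $0$ in each argument. Biproducts are written $\oplus$ and the zero object $\mathsf{0}$ (biproducts are treated as strict); maps between biproducts are written as matrices. Since $\otimes$ preserves the additive structure, $\otimes$ distributes over $\oplus$ via canonical isomorphisms, and $A\otimes\mathsf{0}\cong\mathsf{0}\cong\mathsf{0}\otimes A$. The arrow category $\mathsf{Arr}[\mathbb{X}]$ has as objects the maps $\phi\colon A_0\to A_1$ of $\mathbb{X}$ and as maps $\phi\to\phi'$ the pairs $(f_0\colon A_0\to A_0',\ f_1\colon A_1\to A_1')$ with $f_1\circ\phi=\phi'\circ f_0$; composition and identities are componentwise. The product $\boxtimes$: $(\phi\colon A_0\to A_1)\boxtimes(\psi\colon B_0\to B_1)$ is the map $$\begin{bmatrix}1_{A_0}\otimes\psi\\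 \phi\otimes 1_{B_0}\end{bmatrix}\colon A_0\otimes B_0\to(A_0\otimes B_1)\oplus(A_1\otimes B_0);$$ on maps, $(f_0,f_1)\boxtimes(g_0,g_1)=\left(f_0\otimes g_0,\ \begin{bmatrix}f_0\otimes g_1&0\\0&f_1\otimes g_0\end{bmatrix}\right)$. The unit is $0\colon I\to\mathsf{0}$. The symmetry $\phi\boxtimes\psi\to\psi\boxtimes\phi$ is $$\left(\sigma_{A_0,B_0},\ \begin{bmatrix}0&\sigma_{A_1,B_0}\\ \sigma_{A_0,B_1}&0\end{bmatrix}\colon(A_0\otimes B_1)\oplus(A_1\otimes B_0)\to(B_0\otimes A_1)\oplus(B_1\otimes A_0)\right),$$ and the associativity and unit isomorphisms are the canonical ones coming from distributivity of $\otimes$ over $\oplus$. $\mathsf{CMON}[\mathbb{Y}]$ is the category of commutative monoids and monoid morphisms in a symmetric monoidal category $\mathbb{Y}$. A module over a commutative monoid $(A,\mathsf{m},\mathsf{u})$ in $\mathbb{X}$ is $(M,\alpha\colon A\otimes M\to M)$ with $\alpha\circ(1_A\otimes\alpha)=\alpha\circ(\mathsf{m}\otimes 1_M)$ and $\alpha\circ(\mathsf{u}\otimes 1_M)=1_M$. A derivation $\mathsf{D}\colon(A,\mathsf{m},\mathsf{u})\to(M,\alpha)$ is a map $\mathsf{D}\colon A\to M$ with $\mathsf{D}\circ\mathsf{u}=0$ and $\mathsf{D}\circ\mathsf{m}=\alpha\circ\big((1_A\otimes\mathsf{D})+\sigma_{M,A}\circ(\mathsf{D}\otimes 1_A)\big)$.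 A derivation morphism from $\mathsf{D}\colon(A,\mathsf{m},\mathsf{u})\to(M,\alpha)$ to $\mathsf{D}'\colon(A',\mathsf{m}',\mathsf{u}')\to(M',\alpha')$ is a pair $(f,g)$ with $f\colon(A,\mathsf{m},\mathsf{u})\to(A',\mathsf{m}',\mathsf{u}')$ a monoid morphism and $g\colon M\to M'$ a map such that $g\circ\alpha=\alpha'\circ(f\otimes g)$ and $g\circ\mathsf{D}=\mathsf{D}'\circ f$. $\mathsf{DER}[\mathbb{X}]$ is the category whose objects are all such derivations (with their monoid and module) and whose maps are derivation morphisms. *)

(* Defs.v *)
From mathcomp Require Import all_boot.
From mathcomp Require Import boolp.

Set Implicit Arguments.
Unset Strict Implicit.
Unset Printing Implicit Defensive.

Declare Scope cat_scope.
Delimit Scope cat_scope with cat.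
Local Open Scope cat_scope.

Record category := Category {
  obj :> Type;
  hom : obj -> obj -> Type;
  idm : forall A, hom A A;
  compm : forall A B C, hom B C -> hom A B -> hom A C;
  compmA : forall A B C D (h : hom C D) (g : hom B C) (f : hom A B),
    compm h (compm g f) = compm (compm h g) f;
  comp1m : forall A B (f : hom A B), compm (idm B) f = f;
  compm1 : forall A B (f : hom A B), compm f (idm A) = f
}.

Arguments hom {c} A B.
Arguments idm {c} A.
Arguments compm {c A B C} g f.

Notation "g ∘ f" := (compm g f) (at level 40, left associativity) : cat_scope.
Notation "'id_' A" := (idm A) (at level 8, A at level 8) : cat_scope.

Record functor (C D : category) := Functor {
  fobj :> C -> D;
  fmap : forall A B, hom A B -> hom (fobj A) (fobj B);
  fmap1 : forall A, fmap (id_ A) = id_ (fobj A);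
  fmapM : forall A B E (g : hom B E) (f : hom A B),
    fmap (g ∘ f) = fmap g ∘ fmap f
}.

Arguments fmap {C D} F {A B} f : rename.

Definition functor_id (C : category) : functor C C :=
  @Functor C C (fun A => A) (fun _ _ f => f)
    (fun _ => erefl) (fun _ _ _ _ _ => erefl).

Section FunctorComp.
Variables (C D E : category) (G : functor D E) (F : functor C D).

Lemma functor_comp1 (A : C) : fmap G (fmap F (id_ A)) = id_ (G (F A)).
Proof. by rewrite !fmap1. Qed.

Lemma functor_compM (A B K : C) (g : hom B K) (f : hom A B) :
  fmap G (fmap F (g ∘ f)) = fmap G (fmap F g) ∘ fmap G (fmap F f).
Proof. by rewrite !fmapM. Qed.

Definition functor_comp : functor C E :=
  @Functor C E (fun A => G (F A)) (fun _ _ f => fmap G (fmap F f))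
    functor_comp1 functor_compM.
End FunctorComp.

(* Isomorphism, not equivalence: both composites are equal to the identity. *)
Definition isomorphic_categories (C D : category) : Prop :=
  exists (F : functor C D) (G : functor D C),
    functor_comp G F = functor_id C /\ functor_comp F G = functor_id D.

(* Not assumed strict: associators and unitors are explicit. [symm_unit] follows
   from the other axioms; it is listed as in Mac Lane's definition. *)
Record smc := SMC {
  smc_cat :> category;
  tens : smc_cat -> smc_cat -> smc_cat;
  tensm : forall A A' B B' : smc_cat,
    hom A A' -> hom B B' -> hom (tens A B) (tens A' B');
  munit : smc_cat;
  associator : forall A B C, hom (tens (tens A B) C) (tens A (tens B C));
  associatorV : forall A B C, hom (tens A (tens B C)) (tens (tens A B) C);
  lunitor : forall A, hom (tens munit A) A;
  lunitorV : forall A, hom A (tens munit A);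
  runitor : forall A, hom (tens A munit) A;
  runitorV : forall A, hom A (tens A munit);
  symm : forall A B, hom (tens A B) (tens B A);
  tensm1 : forall A B, tensm (id_ A) (id_ B) = id_ (tens A B);
  tensmM : forall A A' A'' B B' B'' (g : hom A' A'') (f : hom A A')
      (g' : hom B' B'') (f' : hom B B'),
    tensm (g ∘ f) (g' ∘ f') = tensm g g' ∘ tensm f f';
  associatorK : forall A B C,
    associatorV A B C ∘ associator A B C = id_ (tens (tens A B) C);
  associatorVK : forall A B C,
    associator A B C ∘ associatorV A B C = id_ (tens A (tens B C));
  lunitorK : forall A, lunitorV A ∘ lunitor A = id_ (tens munit A);
  lunitorVK : forall A, lunitor A ∘ lunitorV A = id_ A;
  runitorK : forall A, runitorV A ∘ runitor A = id_ (tens A munit);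
  runitorVK : forall A, runitor A ∘ runitorV A = id_ A;
  symmK : forall A B, symm B A ∘ symm A B = id_ (tens A B);
  associator_nat : forall A A' B B' C C'
      (f : hom A A') (g : hom B B') (h : hom C C'),
    associator A' B' C' ∘ tensm (tensm f g) h =
    tensm f (tensm g h) ∘ associator A B C;
  lunitor_nat : forall A A' (f : hom A A'),
    lunitor A' ∘ tensm (id_ munit) f = f ∘ lunitor A;
  runitor_nat : forall A A' (f : hom A A'),
    runitor A' ∘ tensm f (id_ munit) = f ∘ runitor A;
  symm_nat : forall A A' B B' (f : hom A A') (g : hom B B'),
    symm A' B' ∘ tensm f g = tensm g f ∘ symm A B;
  pentagon : forall A B C D,
    tensm (id_ A) (associator B C D) ∘
      (associator A (tens B C) D ∘ tensm (associator A B C) (id_ D)) =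
    associator A B (tens C D) ∘ associator (tens A B) C D;
  triangle : forall A B,
    tensm (id_ A) (lunitor B) ∘ associator A munit B =
    tensm (runitor A) (id_ B);
  hexagon : forall A B C,
    associator B C A ∘ (symm A (tens B C) ∘ associator A B C) =
    tensm (id_ B) (symm A C) ∘ (associator B A C ∘ tensm (symm A B) (id_ C));
  symm_unit : forall A, lunitor A ∘ symm A munit = runitor A
}.

Arguments tens {s} A B.
Arguments tensm {s A A' B B'} f g.
Arguments munit {s}.
Arguments associator {s} A B C.
Arguments associatorV {s} A B C.
Arguments lunitor {s} A.
Arguments lunitorV {s} A.
Arguments runitor {s} A.
Arguments runitorV {s} A.
Arguments symm {s} A B.

Notation "A ⊗ B" := (tens A B) (at level 35, right associativity) : cat_scope.
Notation "f ⊗m g" := (tensm f g) (at level 35, right associativity) : cat_scope.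

Record cmonoid (Y : smc) := CMonoid {
  cmon_obj :> Y;
  cmul : hom (cmon_obj ⊗ cmon_obj) cmon_obj;
  cone : hom munit cmon_obj;
  cmulA : cmul ∘ (cmul ⊗m id_ cmon_obj) =
    cmul ∘ (id_ cmon_obj ⊗m cmul) ∘ associator cmon_obj cmon_obj cmon_obj;
  cmul1m : cmul ∘ (cone ⊗m id_ cmon_obj) = lunitor cmon_obj;
  cmulm1 : cmul ∘ (id_ cmon_obj ⊗m cone) = runitor cmon_obj;
  cmulC : cmul ∘ symm cmon_obj cmon_obj = cmul
}.

Arguments cmul {Y} A : rename.
Arguments cone {Y} A : rename.

Definition is_monoid_morphism (Y : smc) (A B : cmonoid Y) (f : hom A B) : Prop :=
  f ∘ cmul A = cmul B ∘ (f ⊗m f) /\ f ∘ cone A = cone B.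

Record cmonoid_hom (Y : smc) (A B : cmonoid Y) := CMonoidHom {
  cmhom :> hom A B;
  cmhomP : is_monoid_morphism cmhom
}.

Section CMON.
Variable Y : smc.

Lemma is_monoid_morphism_id (A : cmonoid Y) : is_monoid_morphism (id_ A).
Proof. by split; rewrite ?tensm1 ?compm1 comp1m. Qed.

Lemma is_monoid_morphism_comp (A B C : cmonoid Y) (g : hom B C) (f : hom A B) :
  is_monoid_morphism g -> is_monoid_morphism f -> is_monoid_morphism (g ∘ f).
Proof.
move=> [gM g1] [fM f1]; split; last by rewrite -compmA f1.
by rewrite -compmA fM compmA gM -compmA -tensmM.
Qed.

Lemma cmonoid_hom_eq (A B : cmonoid Y) (f g : cmonoid_hom A B) :
  cmhom f = cmhom g -> f = g.
Proof.
by case: f g => [f fP] [g gP] /= e; subst g; rewrite (Prop_irrelevance fP gP).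
Qed.

Definition CMON : category.
Proof.
refine (@Category (cmonoid Y) (@cmonoid_hom Y)
  (fun A => CMonoidHom (is_monoid_morphism_id A))
  (fun A B C g f => CMonoidHom (is_monoid_morphism_comp (cmhomP g) (cmhomP f)))
  _ _ _).
- by move=> *; apply: cmonoid_hom_eq; apply: compmA.
- by move=> *; apply: cmonoid_hom_eq; apply: comp1m.
- by move=> *; apply: cmonoid_hom_eq; apply: compm1.
Defined.
End CMON.

(* Enrichment in commutative monoids; no negatives are assumed. *)
Record additive (C : category) := Additive {
  addm : forall A B : C, hom A B -> hom A B -> hom A B;
  zerom : forall A B : C, hom A B;
  addmA : forall A B, associative (@addm A B);
  addmC : forall A B, commutative (@addm A B);
  add0m : forall A B, left_id (zerom A B) (@addm A B);
  compmDl : forall A B K (g g' : hom B K) (f : hom A B),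
    addm g g' ∘ f = addm (g ∘ f) (g' ∘ f);
  compmDr : forall A B K (g : hom B K) (f f' : hom A B),
    g ∘ addm f f' = addm (g ∘ f) (g ∘ f');
  comp0m : forall A B K (f : hom A B), zerom B K ∘ f = zerom A K;
  compm0 : forall A B K (g : hom B K), g ∘ zerom A B = zerom A K
}.

Arguments addm {C} a {A B} f g.
Arguments zerom {C} a A B.

Record additive_smc := AdditiveSMC {
  asmc_smc :> smc;
  asmc_additive : additive asmc_smc;
  tensmDl : forall (A A' B B' : asmc_smc) (f f' : hom A A') (g : hom B B'),
    addm asmc_additive f f' ⊗m g = addm asmc_additive (f ⊗m g) (f' ⊗m g);
  tensmDr : forall (A A' B B' : asmc_smc) (f : hom A A') (g g' : hom B B'),
    f ⊗m addm asmc_additive g g' = addm asmc_additive (f ⊗m g) (f ⊗m g');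
  tens0m : forall (A A' B B' : asmc_smc) (g : hom B B'),
    zerom asmc_additive A A' ⊗m g = zerom asmc_additive (A ⊗ B) (A' ⊗ B');
  tensm0 : forall (A A' B B' : asmc_smc) (f : hom A A'),
    f ⊗m zerom asmc_additive B B' = zerom asmc_additive (A ⊗ B) (A' ⊗ B')
}.

Notation "f + g" := (addm (asmc_additive _) f g) : cat_scope.
Notation "0" := (zerom (asmc_additive _) _ _) : cat_scope.

Record biproduct (X : additive_smc) (A B : X) := Biproduct {
  bip_obj : X;
  in1 : hom A bip_obj;
  in2 : hom B bip_obj;
  pr1 : hom bip_obj A;
  pr2 : hom bip_obj B;
  pr1_in1 : pr1 ∘ in1 = id_ A;
  pr2_in2 : pr2 ∘ in2 = id_ B;
  pr2_in1 : pr2 ∘ in1 = 0;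
  pr1_in2 : pr1 ∘ in2 = 0;
  in_pr : in1 ∘ pr1 + in2 ∘ pr2 = id_ bip_obj
}.

(* A choice of zero object and of binary biproducts. The zero maps already give
   existence of maps from and to [zero_obj], so only uniqueness is required. *)
Record finite_biproducts (X : additive_smc) := FiniteBiproducts {
  zero_obj : X;
  zero_obj_initial : forall (A : X) (f g : hom zero_obj A), f = g;
  zero_obj_terminal : forall (A : X) (f g : hom A zero_obj), f = g;
  bip : forall A B : X, biproduct A B
}.

Record amodule (X : smc) (A : cmonoid X) := AModule {
  mod_obj :> X;
  mact : hom (A ⊗ mod_obj) mod_obj;
  mactA : mact ∘ (cmul A ⊗m id_ mod_obj) =
    mact ∘ (id_ A ⊗m mact) ∘ associator A A mod_obj;
  mact1 : mact ∘ (cone A ⊗m id_ mod_obj) = lunitor mod_obj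
}.

Arguments mact {X A} M : rename.

Record derivation (X : additive_smc) := Derivation {
  der_mon : cmonoid X;
  der_mod : amodule der_mon;
  der :> hom der_mon der_mod;
  der_one : der ∘ cone der_mon = 0;
  der_mul : der ∘ cmul der_mon =
    mact der_mod ∘
      (id_ der_mon ⊗m der + symm der_mod der_mon ∘ (der ⊗m id_ der_mon))
}.

Record derivation_hom (X : additive_smc) (D D' : derivation X) := DerivationHom {
  dhom_mon : hom (der_mon D) (der_mon D');
  dhom_mod : hom (der_mod D) (der_mod D');
  dhom_monP : is_monoid_morphism dhom_mon;
  dhom_act : dhom_mod ∘ mact (der_mod D) =
    mact (der_mod D') ∘ (dhom_mon ⊗m dhom_mod);
  dhom_der : dhom_mod ∘ D = D' ∘ dhom_mon
}.

Section DER.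
Variable X : additive_smc.

Lemma derivation_hom_eq (D D' : derivation X) (f g : derivation_hom D D') :
  dhom_mon f = dhom_mon g -> dhom_mod f = dhom_mod g -> f = g.
Proof.
case: f g => [f1 f2 a b c] [g1 g2 a' b' c'] /= e1 e2; subst g1 g2.
by rewrite (Prop_irrelevance a a') (Prop_irrelevance b b')
           (Prop_irrelevance c c').
Qed.

Definition derivation_id (D : derivation X) : derivation_hom D D.
Proof.
refine (@DerivationHom X D D (id_ (der_mon D)) (id_ (der_mod D))
          (is_monoid_morphism_id _) _ _).
- by rewrite tensm1 comp1m compm1.
- by rewrite comp1m compm1.
Defined.

Definition derivation_comp (D D' D'' : derivation X)
  (g : derivation_hom D' D'') (f : derivation_hom D D') : derivation_hom D D''.
Proof.
refine (@DerivationHom X D D'' (dhom_mon g ∘ dhom_mon f)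
          (dhom_mod g ∘ dhom_mod f)
          (is_monoid_morphism_comp (dhom_monP g) (dhom_monP f)) _ _).
- by rewrite -compmA dhom_act compmA dhom_act -compmA -tensmM.
- by rewrite -compmA dhom_der compmA dhom_der -compmA.
Defined.

Definition DER : category.
Proof.
refine (@Category (derivation X) (@derivation_hom X) derivation_id
                  derivation_comp _ _ _).
- by move=> *; apply: derivation_hom_eq; apply: compmA.
- by move=> *; apply: derivation_hom_eq; apply: comp1m.
- by move=> *; apply: derivation_hom_eq; apply: compm1.
Defined.
End DER.

Record arrow (C : category) := Arrow {
  arr0 : C;
  arr1 : C;
  arr :> hom arr0 arr1
}.

Record arrow_hom (C : category) (p q : arrow C) := ArrowHom {
  ahom0 : hom (arr0 p) (arr0 q);
  ahom1 : hom (arr1 p) (arr1 q);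
  ahomP : ahom1 ∘ p = q ∘ ahom0
}.

Section Arr.
Variable C : category.

Lemma arrow_hom_eq (p q : arrow C) (f g : arrow_hom p q) :
  ahom0 f = ahom0 g -> ahom1 f = ahom1 g -> f = g.
Proof.
case: f g => [f0 f1 fP] [g0 g1 gP] /= e0 e1; subst g0 g1.
by rewrite (Prop_irrelevance fP gP).
Qed.

Definition arrow_id (p : arrow C) : arrow_hom p p.
Proof.
by refine (@ArrowHom C p p (id_ (arr0 p)) (id_ (arr1 p)) _);
  rewrite comp1m compm1.
Defined.

Definition arrow_comp (p q r : arrow C) (g : arrow_hom q r) (f : arrow_hom p q) :
  arrow_hom p r.
Proof.
by refine (@ArrowHom C p r (ahom0 g ∘ ahom0 f) (ahom1 g ∘ ahom1 f) _);
  rewrite -compmA ahomP compmA ahomP -compmA.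
Defined.

Definition Arr : category.
Proof.
refine (@Category (arrow C) (@arrow_hom C) arrow_id arrow_comp _ _ _).
- by move=> *; apply: arrow_hom_eq; apply: compmA.
- by move=> *; apply: arrow_hom_eq; apply: comp1m.
- by move=> *; apply: arrow_hom_eq; apply: compm1.
Defined.
End Arr.

Section Matrices.
Variables (X : additive_smc) (bX : finite_biproducts X).

Definition bsum (A B : X) : X := bip_obj (bip bX A B).
Local Notation "A ⊕ B" := (bsum A B) (at level 36, right associativity).
Definition inl_ (A B : X) : hom A (A ⊕ B) := in1 (bip bX A B).
Definition inr_ (A B : X) : hom B (A ⊕ B) := in2 (bip bX A B).
Definition prl_ (A B : X) : hom (A ⊕ B) A := pr1 (bip bX A B).
Definition prr_ (A B : X) : hom (A ⊕ B) B := pr2 (bip bX A B).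
Local Notation i1 := (inl_ _ _).
Local Notation i2 := (inr_ _ _).
Local Notation p1 := (prl_ _ _).
Local Notation p2 := (prr_ _ _).

(* [brow f g] is the 1x2 matrix, [bcol f g] the 2x1 matrix and [bmat a b c d] the
   2x2 matrix with rows (a b) and (c d). *)
Definition brow (A B K : X) (f : hom A K) (g : hom B K) : hom (A ⊕ B) K :=
  f ∘ p1 + g ∘ p2.
Definition bcol (A B K : X) (f : hom K A) (g : hom K B) : hom K (A ⊕ B) :=
  i1 ∘ f + i2 ∘ g.
Definition bmat (A B A' B' : X) (a : hom A A') (b : hom B A')
    (c : hom A B') (d : hom B B') : hom (A ⊕ B) (A' ⊕ B') :=
  brow (bcol a c) (bcol b d).

Definition distr (A B K : X) : hom ((A ⊕ B) ⊗ K) ((A ⊗ K) ⊕ (B ⊗ K)) :=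
  bcol (p1 ⊗m id_ K) (p2 ⊗m id_ K).
Definition distl (K A B : X) : hom (K ⊗ (A ⊕ B)) ((K ⊗ A) ⊕ (K ⊗ B)) :=
  bcol (id_ K ⊗m p1) (id_ K ⊗m p2).

Lemma addm0 (A B : X) (f : hom A B) : f + 0 = f.
Proof. by rewrite addmC add0m. Qed.

Lemma row_inl A B K (f : hom A K) (g : hom B K) : brow f g ∘ i1 = f.
Proof. by rewrite compmDl -!compmA pr1_in1 pr2_in1 compm1 compm0 addm0. Qed.

Lemma row_inr A B K (f : hom A K) (g : hom B K) : brow f g ∘ i2 = g.
Proof. by rewrite compmDl -!compmA pr1_in2 pr2_in2 compm1 compm0 add0m. Qed.

Lemma row_ext A B K (f g : hom (A ⊕ B) K) :
  f ∘ i1 = g ∘ i1 -> f ∘ i2 = g ∘ i2 -> f = g.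
Proof.
move=> e1 e2; rewrite -(compm1 f) -(compm1 g) -[id_ (A ⊕ B)](in_pr (bip bX A B)).
by rewrite !compmDr !compmA e1 e2.
Qed.

Lemma tensr_row_ext A B K L (f g : hom ((A ⊕ B) ⊗ K) L) :
  f ∘ (i1 ⊗m id_ K) = g ∘ (i1 ⊗m id_ K) ->
  f ∘ (i2 ⊗m id_ K) = g ∘ (i2 ⊗m id_ K) -> f = g.
Proof.
move=> e1 e2; rewrite -(compm1 f) -(compm1 g) -tensm1.
rewrite -[id_ (A ⊕ B)](in_pr (bip bX A B)) tensmDl !compmDr.
by rewrite -(comp1m (id_ K)) !tensmM !compmA e1 e2.
Qed.

Lemma tensl_row_ext A B K L (f g : hom (K ⊗ (A ⊕ B)) L) :
  f ∘ (id_ K ⊗m i1) = g ∘ (id_ K ⊗m i1) ->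
  f ∘ (id_ K ⊗m i2) = g ∘ (id_ K ⊗m i2) -> f = g.
Proof.
move=> e1 e2; rewrite -(compm1 f) -(compm1 g) -tensm1.
rewrite -[id_ (A ⊕ B)](in_pr (bip bX A B)) tensmDr !compmDr.
by rewrite -(comp1m (id_ K)) !tensmM !compmA e1 e2.
Qed.

Lemma tensrr_row_ext A B K K' L (f g : hom (((A ⊕ B) ⊗ K) ⊗ K') L) :
  f ∘ ((i1 ⊗m id_ K) ⊗m id_ K') = g ∘ ((i1 ⊗m id_ K) ⊗m id_ K') ->
  f ∘ ((i2 ⊗m id_ K) ⊗m id_ K') = g ∘ ((i2 ⊗m id_ K) ⊗m id_ K') -> f = g.
Proof.
move=> e1 e2; rewrite -(compm1 f) -(compm1 g) -!tensm1.
rewrite -[id_ (A ⊕ B)](in_pr (bip bX A B)) !tensmDl !compmDr.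
by rewrite -(comp1m (id_ K)) -(comp1m (id_ K')) !tensmM !compmA e1 e2.
Qed.
End Matrices.

Section ArrMonoidal.
Variables (X : additive_smc) (bX : finite_biproducts X).
Implicit Types p q r s : arrow X.

Local Notation "A ⊕ B" := (bsum bX A B) (at level 36, right associativity).
Local Notation i1 := (inl_ bX _ _).
Local Notation i2 := (inr_ bX _ _).
Local Notation p1 := (prl_ bX _ _).
Local Notation p2 := (prr_ bX _ _).
Local Notation row := (brow bX).
Local Notation col := (bcol bX).
Local Notation mat := (bmat bX).

(* Below, the index 1 marks the component of a map of arrows between codomains;
   the component between domains is the structure map of [X]. *)
Definition arr_tens p q : arrow X :=
  @Arrow X (arr0 p ⊗ arr0 q) ((arr0 p ⊗ arr1 q) ⊕ (arr1 p ⊗ arr0 q))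
    (col (id_ (arr0 p) ⊗m q) (p ⊗m id_ (arr0 q))).

Definition arr_unit : arrow X := @Arrow X munit (zero_obj bX) 0.

Definition arr_tensm1 p p' q q' (f : arrow_hom p p') (g : arrow_hom q q') :
  hom (arr1 (arr_tens p q)) (arr1 (arr_tens p' q')) :=
  mat (ahom0 f ⊗m ahom1 g) 0 0 (ahom1 f ⊗m ahom0 g).

Definition arr_symm1 p q :
  hom (arr1 (arr_tens p q)) (arr1 (arr_tens q p)) :=
  mat 0 (symm (arr1 p) (arr0 q)) (symm (arr0 p) (arr1 q)) 0.

(* On (A0 ⊗ B0) ⊗ C1, (A0 ⊗ B1) ⊗ C0 and (A1 ⊗ B0) ⊗ C0 this is the associator
   of [X], followed by the inclusion into
   A0 ⊗ ((B0 ⊗ C1) ⊕ (B1 ⊗ C0)) ⊕ A1 ⊗ (B0 ⊗ C0). *)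
Definition arr_associator1 p q r :
  hom (arr1 (arr_tens (arr_tens p q) r)) (arr1 (arr_tens p (arr_tens q r))) :=
  row (i1 ∘ (id_ (arr0 p) ⊗m i1) ∘ associator (arr0 p) (arr0 q) (arr1 r))
      (row (i1 ∘ (id_ (arr0 p) ⊗m i2) ∘ associator (arr0 p) (arr1 q) (arr0 r))
           (i2 ∘ associator (arr1 p) (arr0 q) (arr0 r))
         ∘ distr bX _ _ _).

Definition arr_associatorV1 p q r :
  hom (arr1 (arr_tens p (arr_tens q r))) (arr1 (arr_tens (arr_tens p q) r)) :=
  row (row (i1 ∘ associatorV (arr0 p) (arr0 q) (arr1 r))
           (i2 ∘ (i1 ⊗m id_ (arr0 r)) ∘ associatorV (arr0 p) (arr1 q) (arr0 r))
         ∘ distl bX _ _ _)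
      (i2 ∘ (i2 ⊗m id_ (arr0 r)) ∘ associatorV (arr1 p) (arr0 q) (arr0 r)).

(* The discarded summands 0 ⊗ A0 and A0 ⊗ 0 are zero objects. *)
Definition arr_lunitor1 p : hom (arr1 (arr_tens arr_unit p)) (arr1 p) :=
  row (lunitor (arr1 p)) 0.
Definition arr_lunitorV1 p : hom (arr1 p) (arr1 (arr_tens arr_unit p)) :=
  col (lunitorV (arr1 p)) 0.
Definition arr_runitor1 p : hom (arr1 (arr_tens p arr_unit)) (arr1 p) :=
  row 0 (runitor (arr1 p)).
Definition arr_runitorV1 p : hom (arr1 p) (arr1 (arr_tens p arr_unit)) :=
  col 0 (runitorV (arr1 p)).

Lemma reA A B K L (g : @hom X B K) (f : hom A B) h (k : hom L A) :
  g ∘ f = h -> g ∘ (f ∘ k) = h ∘ k.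
Proof. by move=> <-; rewrite compmA. Qed.

Lemma ttE A A' A'' B B' B'' (g : @hom X A' A'') (f : hom A A')
    (g' : @hom X B' B'') (f' : hom B B') :
  (g ⊗m g') ∘ (f ⊗m f') = (g ∘ f) ⊗m (g' ∘ f').
Proof. by rewrite tensmM. Qed.

Lemma diag_inl A A' B B' (f : @hom X A A') (g : @hom X B B') :
  mat f 0 0 g ∘ i1 = i1 ∘ f.
Proof. by rewrite row_inl /bcol compm0 addm0. Qed.

Lemma diag_inr A A' B B' (f : @hom X A A') (g : @hom X B B') :
  mat f 0 0 g ∘ i2 = i2 ∘ g.
Proof. by rewrite row_inr /bcol compm0 add0m. Qed.

Lemma anti_inl A A' B B' (f : @hom X A A') (g : @hom X B B') :
  mat 0 g f 0 ∘ i1 = i2 ∘ f.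
Proof. by rewrite row_inl /bcol compm0 add0m. Qed.

Lemma anti_inr A A' B B' (f : @hom X A A') (g : @hom X B B') :
  mat 0 g f 0 ∘ i2 = i1 ∘ g.
Proof. by rewrite row_inr /bcol compm0 addm0. Qed.

Lemma distr_inl A B K K' (f : hom K K') :
  distr bX A B K' ∘ (i1 ⊗m f) = i1 ∘ (id_ A ⊗m f).
Proof.
rewrite /distr /bcol compmDl -!compmA !ttE pr1_in1 pr2_in1 comp1m.
by rewrite tens0m compm0 addm0.
Qed.

Lemma distr_inr A B K K' (f : hom K K') :
  distr bX A B K' ∘ (i2 ⊗m f) = i2 ∘ (id_ B ⊗m f).
Proof.
rewrite /distr /bcol compmDl -!compmA !ttE pr2_in2 pr1_in2 comp1m.
by rewrite tens0m compm0 add0m.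
Qed.

Lemma distl_inl A B K K' (f : hom K K') :
  distl bX K' A B ∘ (f ⊗m i1) = i1 ∘ (f ⊗m id_ A).
Proof.
rewrite /distl /bcol compmDl -!compmA !ttE pr1_in1 pr2_in1 comp1m.
by rewrite tensm0 compm0 addm0.
Qed.

Lemma distl_inr A B K K' (f : hom K K') :
  distl bX K' A B ∘ (f ⊗m i2) = i2 ∘ (f ⊗m id_ B).
Proof.
rewrite /distl /bcol compmDl -!compmA !ttE pr2_in2 pr1_in2 comp1m.
by rewrite tensm0 compm0 add0m.
Qed.

Lemma col_post A B K L (f : hom K A) (g : hom K B) (k : hom L K) :
  col f g ∘ k = col (f ∘ k) (g ∘ k).
Proof. by rewrite /bcol compmDl -!compmA. Qed.

Lemma row_col A B K L (f : hom A L) (g : hom B L) (h : hom K A) (k : hom K B) :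
  row f g ∘ col h k = f ∘ h + g ∘ k.
Proof. by rewrite /bcol compmDr !compmA row_inl row_inr. Qed.

Lemma diag_col A A' B B' K (f : @hom X A A') (g : @hom X B B')
    (h : hom K A) (k : hom K B) :
  mat f 0 0 g ∘ col h k = col (f ∘ h) (g ∘ k).
Proof. by rewrite {2}/bcol compmDr !compmA diag_inl diag_inr -!compmA. Qed.

Lemma anti_col A A' B B' K (f : @hom X A A') (g : @hom X B B')
    (h : hom K A) (k : hom K B) :
  mat 0 g f 0 ∘ col h k = col (g ∘ k) (f ∘ h).
Proof.
by rewrite {2}/bcol compmDr !compmA anti_inl anti_inr -!compmA addmC.
Qed.

Lemma assoc1_inl p q r :
  arr_associator1 p q r ∘ i1 =
  i1 ∘ ((id_ (arr0 p) ⊗m i1) ∘ associator (arr0 p) (arr0 q) (arr1 r)).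
Proof. by rewrite row_inl -compmA. Qed.

Lemma assoc1_inrl p q r K (f : hom K (arr0 r)) :
  arr_associator1 p q r ∘ (i2 ∘ (i1 ⊗m f)) =
  i1 ∘ ((id_ (arr0 p) ⊗m i2) ∘ (associator (arr0 p) (arr1 q) (arr0 r)
     ∘ (id_ _ ⊗m f))).
Proof.
rewrite /arr_associator1 (compmA _ i2) row_inr -!compmA distr_inl (compmA _ i1).
by rewrite row_inl -!compmA.
Qed.

Lemma assoc1_inrr p q r K (f : hom K (arr0 r)) :
  arr_associator1 p q r ∘ (i2 ∘ (i2 ⊗m f)) =
  i2 ∘ (associator (arr1 p) (arr0 q) (arr0 r) ∘ (id_ _ ⊗m f)).
Proof.
rewrite /arr_associator1 (compmA _ i2) row_inr -!compmA distr_inr (compmA _ i2).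
by rewrite row_inr -!compmA.
Qed.

Lemma assocV1_inr p q r :
  arr_associatorV1 p q r ∘ i2 =
  i2 ∘ ((i2 ⊗m id_ (arr0 r)) ∘ associatorV (arr1 p) (arr0 q) (arr0 r)).
Proof. by rewrite row_inr -compmA. Qed.

Lemma assocV1_inll p q r K (f : hom K (arr0 p)) :
  arr_associatorV1 p q r ∘ (i1 ∘ (f ⊗m i1)) =
  i1 ∘ (associatorV (arr0 p) (arr0 q) (arr1 r) ∘ (f ⊗m id_ _)).
Proof.
rewrite /arr_associatorV1 (compmA _ i1) row_inl -!compmA distl_inl (compmA _ i1).
by rewrite row_inl -!compmA.
Qed.

Lemma assocV1_inlr p q r K (f : hom K (arr0 p)) :
  arr_associatorV1 p q r ∘ (i1 ∘ (f ⊗m i2)) =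
  i2 ∘ ((i1 ⊗m id_ _) ∘ (associatorV (arr0 p) (arr1 q) (arr0 r)
     ∘ (f ⊗m id_ _))).
Proof.
rewrite /arr_associatorV1 (compmA _ i1) row_inl -!compmA distl_inr (compmA _ i2).
by rewrite row_inr -!compmA.
Qed.

Lemma arr_tensmP p p' q q' (f : arrow_hom p p') (g : arrow_hom q q') :
  arr_tensm1 f g ∘ arr_tens p q =
  arr_tens p' q' ∘ (ahom0 f ⊗m ahom0 g).
Proof.
by rewrite /arr_tensm1 /= diag_col col_post !ttE !ahomP !compm1 !comp1m.
Qed.

Lemma arr_symmP p q :
  arr_symm1 p q ∘ arr_tens p q =
  arr_tens q p ∘ symm (arr0 p) (arr0 q).
Proof. by rewrite /arr_symm1 /= anti_col col_post !symm_nat. Qed.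

Lemma bcol_tens A B K L L' (f : hom K A) (g : hom K B) (h : @hom X L L') :
  col f g ⊗m h = (i1 ⊗m id_ L') ∘ (f ⊗m h) + (i2 ⊗m id_ L') ∘ (g ⊗m h).
Proof. by rewrite !ttE !comp1m -tensmDl. Qed.

Lemma tens_bcol A B K L L' (f : hom K A) (g : hom K B) (h : @hom X L L') :
  h ⊗m col f g = (id_ L' ⊗m i1) ∘ (h ⊗m f) + (id_ L' ⊗m i2) ∘ (h ⊗m g).
Proof. by rewrite !ttE !comp1m -tensmDr. Qed.

Lemma comp_bcol A B K L (h : hom (A ⊕ B) L) (f : hom K A) (g : hom K B) :
  h ∘ col f g = h ∘ i1 ∘ f + h ∘ i2 ∘ g.
Proof. by rewrite /bcol compmDr !compmA. Qed.

Lemma arr_associatorP p q r :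
  arr_associator1 p q r ∘ arr_tens (arr_tens p q) r =
  arr_tens p (arr_tens q r) ∘ associator (arr0 p) (arr0 q) (arr0 r).
Proof.
rewrite /= comp_bcol assoc1_inl bcol_tens compmDr col_post tens_bcol.
rewrite compmDl !(compmA _ (_ ⊗m _) (_ ⊗m _)) -!(compmA _ i2).
rewrite assoc1_inrl assoc1_inrr !tensm1 !compm1 -!compmA -!tensm1.
by rewrite !associator_nat /bcol compmDr addmA.
Qed.

Lemma zero_tensl_ext A B (f g : hom (zero_obj bX ⊗ A) B) : f = g.
Proof.
rewrite -(compm1 f) -(compm1 g) -tensm1.
by rewrite (zero_obj_initial (id_ (zero_obj bX)) 0) tens0m !compm0.
Qed.

Lemma zero_tensr_ext A B (f g : hom (A ⊗ zero_obj bX) B) : f = g.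
Proof.
rewrite -(compm1 f) -(compm1 g) -tensm1.
by rewrite (zero_obj_initial (id_ (zero_obj bX)) 0) tensm0 !compm0.
Qed.

Lemma arr_lunitorP p :
  arr_lunitor1 p ∘ arr_tens arr_unit p = p ∘ lunitor (arr0 p).
Proof. by rewrite /= row_col comp0m addm0 lunitor_nat. Qed.

Lemma arr_runitorP p :
  arr_runitor1 p ∘ arr_tens p arr_unit = p ∘ runitor (arr0 p).
Proof. by rewrite /= row_col comp0m add0m runitor_nat. Qed.

Lemma arr_lunitorK1 p : arr_lunitorV1 p ∘ arr_lunitor1 p = id_ _.
Proof.
apply: row_ext; last exact: zero_tensl_ext.
by rewrite -compmA row_inl comp1m /arr_lunitorV1 /bcol compm0 addm0 -compmA
   lunitorK compm1.
Qed.

Lemma arr_lunitorVK1 p : arr_lunitor1 p ∘ arr_lunitorV1 p = id_ _.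
Proof. by rewrite row_col comp0m addm0 lunitorVK. Qed.

Lemma arr_runitorK1 p : arr_runitorV1 p ∘ arr_runitor1 p = id_ _.
Proof.
apply: row_ext; first exact: zero_tensr_ext.
by rewrite -compmA row_inr comp1m /arr_runitorV1 /bcol compm0 add0m -compmA
   runitorK compm1.
Qed.

Lemma arr_runitorVK1 p : arr_runitor1 p ∘ arr_runitorV1 p = id_ _.
Proof. by rewrite row_col comp0m add0m runitorVK. Qed.

Lemma arr_symmK1 p q : arr_symm1 q p ∘ arr_symm1 p q = id_ _.
Proof.
apply: row_ext.
  by rewrite -compmA anti_inl compmA anti_inr -compmA symmK comp1m compm1.
by rewrite -compmA anti_inr compmA anti_inl -compmA symmK comp1m compm1.
Qed.

Lemma arr_associatorK1 p q r :
  arr_associatorV1 p q r ∘ arr_associator1 p q r = id_ _.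
Proof.
apply: row_ext.
  rewrite -compmA assoc1_inl (compmA i1) compmA assocV1_inll tensm1 compm1.
  by rewrite -compmA associatorK comp1m compm1.
rewrite comp1m; apply: tensr_row_ext.
  rewrite -!compmA assoc1_inrl tensm1 compm1 (compmA i1) compmA assocV1_inlr.
  by rewrite tensm1 compm1 -!compmA associatorK compm1.
rewrite -!compmA assoc1_inrr tensm1 compm1 compmA assocV1_inr.
by rewrite -!compmA associatorK compm1.
Qed.

Lemma arr_associatorVK1 p q r :
  arr_associator1 p q r ∘ arr_associatorV1 p q r = id_ _.
Proof.
apply: row_ext; last first.
  rewrite -compmA assocV1_inr (compmA i2) compmA assoc1_inrr tensm1 compm1.
  by rewrite -compmA associatorVK comp1m compm1.
rewrite comp1m; apply: tensl_row_ext.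
  rewrite -!compmA assocV1_inll tensm1 compm1 compmA assoc1_inl.
  by rewrite -!compmA associatorVK compm1.
rewrite -!compmA assocV1_inlr tensm1 compm1 (compmA i2) compmA assoc1_inrl.
by rewrite tensm1 compm1 -!compmA associatorVK compm1.
Qed.

Lemma arr_tensm11 p q : arr_tensm1 (arrow_id p) (arrow_id q) = id_ _.
Proof.
rewrite /arr_tensm1 /=; apply: row_ext.
  by rewrite diag_inl tensm1 compm1 comp1m.
by rewrite diag_inr tensm1 compm1 comp1m.
Qed.

Lemma arr_tensmM1 p p' p'' q q' q''
    (g : arrow_hom p' p'') (f : arrow_hom p p')
    (g' : arrow_hom q' q'') (f' : arrow_hom q q') :
  arr_tensm1 (arrow_comp g f) (arrow_comp g' f') =
  arr_tensm1 g g' ∘ arr_tensm1 f f'.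
Proof.
rewrite /arr_tensm1 /=; apply: row_ext.
  by rewrite diag_inl -compmA diag_inl compmA diag_inl tensmM -compmA.
by rewrite diag_inr -compmA diag_inr compmA diag_inr tensmM -compmA.
Qed.

Definition arr_tens_hom p p' q q' (f : arrow_hom p p') (g : arrow_hom q q') :
  arrow_hom (arr_tens p q) (arr_tens p' q') := ArrowHom (arr_tensmP f g).

Lemma tens_diag_inl A A' B B' K K' (k : hom K K')
    (f : @hom X A A') (g : @hom X B B') :
  (k ⊗m mat f 0 0 g) ∘ (id_ K ⊗m i1) = (id_ K' ⊗m i1) ∘ (k ⊗m f).
Proof. by rewrite !ttE diag_inl compm1 comp1m. Qed.

Lemma tens_diag_inr A A' B B' K K' (k : hom K K')
    (f : @hom X A A') (g : @hom X B B') :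
  (k ⊗m mat f 0 0 g) ∘ (id_ K ⊗m i2) = (id_ K' ⊗m i2) ∘ (k ⊗m g).
Proof. by rewrite !ttE diag_inr compm1 comp1m. Qed.

Lemma diag_tens_inl A A' B B' K K' (k : hom K K')
    (f : @hom X A A') (g : @hom X B B') :
  (mat f 0 0 g ⊗m k) ∘ (i1 ⊗m id_ K) = (i1 ⊗m id_ K') ∘ (f ⊗m k).
Proof. by rewrite !ttE diag_inl compm1 comp1m. Qed.

Lemma diag_tens_inr A A' B B' K K' (k : hom K K')
    (f : @hom X A A') (g : @hom X B B') :
  (mat f 0 0 g ⊗m k) ∘ (i2 ⊗m id_ K) = (i2 ⊗m id_ K') ∘ (g ⊗m k).
Proof. by rewrite !ttE diag_inr compm1 comp1m. Qed.

Lemma tens_anti_inl A A' B B' K K' (k : hom K K')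
    (f : @hom X A A') (g : @hom X B B') :
  (k ⊗m mat 0 g f 0) ∘ (id_ K ⊗m i1) = (id_ K' ⊗m i2) ∘ (k ⊗m f).
Proof. by rewrite !ttE anti_inl compm1 comp1m. Qed.

Lemma tens_anti_inr A A' B B' K K' (k : hom K K')
    (f : @hom X A A') (g : @hom X B B') :
  (k ⊗m mat 0 g f 0) ∘ (id_ K ⊗m i2) = (id_ K' ⊗m i1) ∘ (k ⊗m g).
Proof. by rewrite !ttE anti_inr compm1 comp1m. Qed.

Lemma anti_tens_inl A A' B B' K K' (k : hom K K')
    (f : @hom X A A') (g : @hom X B B') :
  (mat 0 g f 0 ⊗m k) ∘ (i1 ⊗m id_ K) = (i2 ⊗m id_ K') ∘ (f ⊗m k).
Proof. by rewrite !ttE anti_inl compm1 comp1m. Qed.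

Lemma anti_tens_inr A A' B B' K K' (k : hom K K')
    (f : @hom X A A') (g : @hom X B B') :
  (mat 0 g f 0 ⊗m k) ∘ (i2 ⊗m id_ K) = (i1 ⊗m id_ K') ∘ (g ⊗m k).
Proof. by rewrite !ttE anti_inr compm1 comp1m. Qed.

Lemma assoc1_inrl1 p q r :
  arr_associator1 p q r ∘ (i2 ∘ (i1 ⊗m id_ (arr0 r))) =
  i1 ∘ ((id_ (arr0 p) ⊗m i2) ∘ associator (arr0 p) (arr1 q) (arr0 r)).
Proof. by rewrite assoc1_inrl tensm1 compm1. Qed.

Lemma assoc1_inrr1 p q r :
  arr_associator1 p q r ∘ (i2 ∘ (i2 ⊗m id_ (arr0 r))) =
  i2 ∘ associator (arr1 p) (arr0 q) (arr0 r).
Proof. by rewrite assoc1_inrr tensm1 compm1. Qed.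

Lemma arr_associator_nat1 p p' q q' r r'
    (f : arrow_hom p p') (g : arrow_hom q q') (h : arrow_hom r r') :
  arr_associator1 p' q' r' ∘ arr_tensm1 (arr_tens_hom f g) h =
  arr_tensm1 f (arr_tens_hom g h) ∘ arr_associator1 p q r.
Proof.
apply: row_ext.
  rewrite -!compmA diag_inl assoc1_inl (reA _ (assoc1_inl _ _ _)) (reA _ (diag_inl _ _)).
  rewrite -!compmA (reA _ (tens_diag_inl _ _ _)) -compmA.
  by rewrite associator_nat.
apply: tensr_row_ext; rewrite -!compmA.
  rewrite assoc1_inrl1 (reA _ (diag_inr _ _)) (reA _ (diag_inl _ _)) -!compmA.
  rewrite (reA _ (tens_diag_inr _ _ _)) (diag_tens_inl _ _ _).
  by rewrite (compmA i2) (reA _ (assoc1_inrl1 _ _ _)) -!compmA associator_nat.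
rewrite assoc1_inrr1 (reA _ (diag_inr _ _)) (reA _ (diag_inr _ _)) -!compmA.
rewrite (diag_tens_inr _ _ _).
by rewrite (compmA i2 (i2 ⊗m _)) (reA _ (assoc1_inrr1 _ _ _)) -!compmA associator_nat.
Qed.

Lemma arr_lunitor_nat1 p p' (f : arrow_hom p p') :
  arr_lunitor1 p' ∘ arr_tensm1 (arrow_id arr_unit) f =
  ahom1 f ∘ arr_lunitor1 p.
Proof.
apply: row_ext; last exact: zero_tensl_ext.
by rewrite -!compmA diag_inl row_inl (reA _ (row_inl _ _ _)) lunitor_nat.
Qed.

Lemma arr_runitor_nat1 p p' (f : arrow_hom p p') :
  arr_runitor1 p' ∘ arr_tensm1 f (arrow_id arr_unit) =
  ahom1 f ∘ arr_runitor1 p.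
Proof.
apply: row_ext; first exact: zero_tensr_ext.
by rewrite -!compmA diag_inr row_inr (reA _ (row_inr _ _ _)) runitor_nat.
Qed.

Lemma arr_symm_nat1 p p' q q' (f : arrow_hom p p') (g : arrow_hom q q') :
  arr_symm1 p' q' ∘ arr_tensm1 f g = arr_tensm1 g f ∘ arr_symm1 p q.
Proof.
apply: row_ext; rewrite -!compmA.
  rewrite diag_inl anti_inl (reA _ (anti_inl _ _)) (reA _ (diag_inr _ _)).
  by rewrite -!compmA symm_nat.
rewrite diag_inr anti_inr (reA _ (anti_inr _ _)) (reA _ (diag_inl _ _)).
by rewrite -!compmA symm_nat.
Qed.

Lemma arr_symm_unit1 p : arr_lunitor1 p ∘ arr_symm1 p arr_unit = arr_runitor1 p.
Proof.
apply: row_ext; first exact: zero_tensr_ext.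
by rewrite -compmA anti_inr row_inr compmA row_inl symm_unit.
Qed.

Definition arr_associator_hom p q r :
    arrow_hom (arr_tens (arr_tens p q) r) (arr_tens p (arr_tens q r)) :=
  ArrowHom (arr_associatorP p q r).
Definition arr_lunitor_hom p : arrow_hom (arr_tens arr_unit p) p :=
  ArrowHom (arr_lunitorP p).
Definition arr_runitor_hom p : arrow_hom (arr_tens p arr_unit) p :=
  ArrowHom (arr_runitorP p).
Definition arr_symm_hom p q : arrow_hom (arr_tens p q) (arr_tens q p) :=
  ArrowHom (arr_symmP p q).

Lemma arr_triangle1 p q :
  arr_tensm1 (arrow_id p) (arr_lunitor_hom q) ∘ arr_associator1 p arr_unit q =
  arr_tensm1 (arr_runitor_hom p) (arrow_id q).
Proof.
apply: row_ext.
  rewrite -compmA assoc1_inl diag_inl (reA _ (diag_inl _ _)) -compmA /=.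
  by rewrite (compmA (_ ⊗m _)) ttE row_inl compm1 triangle.
apply: tensr_row_ext; rewrite -!compmA.
  by rewrite (zero_tensr_ext i1 0) tens0m !compm0.
rewrite assoc1_inrr1 (reA _ (diag_inr _ _)) (reA _ (diag_inr _ _)) -!compmA /=.
by rewrite ttE row_inr compm1 triangle.
Qed.

Lemma tensL A B B' D K L (g : @hom X B D) (f : @hom X A B)
    (h : hom B' D) (h' : hom A B') (k : hom L (K ⊗ A)) :
  g ∘ f = h ∘ h' ->
  (id_ K ⊗m g) ∘ ((id_ K ⊗m f) ∘ k) = (id_ K ⊗m h) ∘ ((id_ K ⊗m h') ∘ k).
Proof. by move=> e; rewrite !compmA !ttE e. Qed.

Lemma tensR A B B' D K L (g : @hom X B D) (f : @hom X A B)
    (h : hom B' D) (h' : hom A B') (k : hom L (A ⊗ K)) :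
  g ∘ f = h ∘ h' ->
  (g ⊗m id_ K) ∘ ((f ⊗m id_ K) ∘ k) = (h ⊗m id_ K) ∘ ((h' ⊗m id_ K) ∘ k).
Proof. by move=> e; rewrite !compmA !ttE e. Qed.

Lemma tensL3 A B B' D E E' K L (g : @hom X B D) (f : @hom X A B) (e : hom E A)
    (h : hom B' D) (h' : hom E' B') (h'' : hom E E') (k : hom L (K ⊗ E)) :
  g ∘ (f ∘ e) = h ∘ (h' ∘ h'') ->
  (id_ K ⊗m g) ∘ ((id_ K ⊗m f) ∘ ((id_ K ⊗m e) ∘ k)) =
  (id_ K ⊗m h) ∘ ((id_ K ⊗m h') ∘ ((id_ K ⊗m h'') ∘ k)).
Proof. by move=> eq1; rewrite !(compmA, ttE, compm1) -!compmA eq1. Qed.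

Lemma tensL32 A B B' D E K L (g : @hom X B D) (f : @hom X A B) (e : hom E A)
    (h : hom B' D) (h' : hom E B') (k : hom L (K ⊗ E)) :
  g ∘ (f ∘ e) = h ∘ h' ->
  (id_ K ⊗m g) ∘ ((id_ K ⊗m f) ∘ ((id_ K ⊗m e) ∘ k)) =
  (id_ K ⊗m h) ∘ ((id_ K ⊗m h') ∘ k).
Proof. by move=> eq1; rewrite !(compmA, ttE, compm1) -!compmA eq1. Qed.

Lemma tensR3 A B B' D E E' K L (g : @hom X B D) (f : @hom X A B) (e : hom E A)
    (h : hom B' D) (h' : hom E' B') (h'' : hom E E') (k : hom L (E ⊗ K)) :
  g ∘ (f ∘ e) = h ∘ (h' ∘ h'') ->
  (g ⊗m id_ K) ∘ ((f ⊗m id_ K) ∘ ((e ⊗m id_ K) ∘ k)) =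
  (h ⊗m id_ K) ∘ ((h' ⊗m id_ K) ∘ ((h'' ⊗m id_ K) ∘ k)).
Proof. by move=> eq1; rewrite !(compmA, ttE, compm1) -!compmA eq1. Qed.

Lemma tensR32 A B B' D E K L (g : @hom X B D) (f : @hom X A B) (e : hom E A)
    (h : hom B' D) (h' : hom E B') (k : hom L (E ⊗ K)) :
  g ∘ (f ∘ e) = h ∘ h' ->
  (g ⊗m id_ K) ∘ ((f ⊗m id_ K) ∘ ((e ⊗m id_ K) ∘ k)) =
  (h ⊗m id_ K) ∘ ((h' ⊗m id_ K) ∘ k).
Proof. by move=> eq1; rewrite !(compmA, ttE, compm1) -!compmA eq1. Qed.

Lemma assoc1_inlk p q r K (k : hom K _) :
  arr_associator1 p q r ∘ (i1 ∘ k) =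
  i1 ∘ ((id_ (arr0 p) ⊗m i1) ∘ (associator (arr0 p) (arr0 q) (arr1 r) ∘ k)).
Proof. by rewrite (reA _ (assoc1_inl _ _ _)) -!compmA. Qed.

Lemma assoc1_inrlk p q r K (k : hom K _) :
  arr_associator1 p q r ∘ (i2 ∘ ((i1 ⊗m id_ (arr0 r)) ∘ k)) =
  i1 ∘ ((id_ (arr0 p) ⊗m i2) ∘ (associator (arr0 p) (arr1 q) (arr0 r) ∘ k)).
Proof.
by rewrite (compmA i2) (reA _ (assoc1_inrl1 _ _ _)) -!compmA.
Qed.

Lemma assoc1_inrrk p q r K (k : hom K _) :
  arr_associator1 p q r ∘ (i2 ∘ ((i2 ⊗m id_ (arr0 r)) ∘ k)) =
  i2 ∘ (associator (arr1 p) (arr0 q) (arr0 r) ∘ k).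
Proof.
by rewrite (compmA i2 (i2 ⊗m _)) (reA _ (assoc1_inrr1 _ _ _)) -!compmA.
Qed.

Lemma tens_compl K A B D (g : @hom X B D) (f : @hom X A B) :
  id_ K ⊗m (g ∘ f) = (id_ K ⊗m g) ∘ (id_ K ⊗m f).
Proof. by rewrite ttE comp1m. Qed.

Lemma tens_compr K A B D (g : @hom X B D) (f : @hom X A B) :
  (g ∘ f) ⊗m id_ K = (g ⊗m id_ K) ∘ (f ⊗m id_ K).
Proof. by rewrite ttE comp1m. Qed.

Lemma associator_natl A B C C' L (f : hom C C') (k : @hom X L ((A ⊗ B) ⊗ C)) :
  associator A B C' ∘ ((id_ (A ⊗ B) ⊗m f) ∘ k) =
  (id_ A ⊗m (id_ B ⊗m f)) ∘ (associator A B C ∘ k).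
Proof. by rewrite -tensm1 (reA _ (associator_nat _ _ _)) -compmA. Qed.

Lemma associator_natm A B B' C L (f : hom B B') (k : @hom X L ((A ⊗ B) ⊗ C)) :
  associator A B' C ∘ (((id_ A ⊗m f) ⊗m id_ C) ∘ k) =
  (id_ A ⊗m (f ⊗m id_ C)) ∘ (associator A B C ∘ k).
Proof. by rewrite (reA _ (associator_nat _ _ _)) -compmA. Qed.

Lemma associator_natr A A' B C L (f : hom A A') (k : @hom X L ((A ⊗ B) ⊗ C)) :
  associator A' B C ∘ (((f ⊗m id_ B) ⊗m id_ C) ∘ k) =
  (f ⊗m id_ (B ⊗ C)) ∘ (associator A B C ∘ k).
Proof. by rewrite -tensm1 (reA _ (associator_nat _ _ _)) -compmA. Qed.

Lemma arr_hexagon1 p q r :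
  arr_associator1 q r p ∘ (arr_symm1 p (arr_tens q r) ∘ arr_associator1 p q r) =
  arr_tensm1 (arrow_id q) (arr_symm_hom p r) ∘
    (arr_associator1 q p r ∘ arr_tensm1 (arr_symm_hom p q) (arrow_id r)).
Proof.
apply: row_ext.
  rewrite -!compmA diag_inl assoc1_inl (reA _ (anti_inl _ _)) -!compmA.
  rewrite assoc1_inlk (reA _ (diag_inl _ _)) -!compmA /=.
  rewrite (compmA (symm _ _)) symm_nat -compmA assoc1_inrlk.
  by rewrite (reA _ (tens_anti_inl _ _ _)) -!compmA hexagon.
apply: tensr_row_ext; rewrite -!compmA.
  rewrite assoc1_inrl1 (reA _ (anti_inl _ _)) -!compmA.
  rewrite (compmA (symm _ _)) symm_nat -compmA assoc1_inrrk.
  rewrite (reA _ (diag_inr _ _)) -compmA /= anti_tens_inl assoc1_inrrk.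
  by rewrite (reA _ (diag_inr _ _)) -compmA hexagon.
rewrite assoc1_inrr1 (reA _ (anti_inr _ _)) -!compmA assoc1_inlk.
rewrite (reA _ (diag_inr _ _)) -compmA /= anti_tens_inr assoc1_inrlk.
rewrite (reA _ (diag_inl _ _)) -compmA (reA _ (tens_anti_inr _ _ _)).
by rewrite -!compmA hexagon.
Qed.

Lemma arr_pentagon1 p q r s :
  arr_tensm1 (arrow_id p) (arr_associator_hom q r s) ∘
    (arr_associator1 p (arr_tens q r) s ∘
       arr_tensm1 (arr_associator_hom p q r) (arrow_id s)) =
  arr_associator1 p q (arr_tens r s) ∘ arr_associator1 (arr_tens p q) r s.
Proof.
apply: row_ext.
  rewrite -!compmA diag_inl assoc1_inl !assoc1_inlk (reA _ (diag_inl _ _)).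
  rewrite -!compmA /= (tensL _ (assoc1_inl _ _ _)) associator_natl -pentagon.
  by rewrite tens_compl -!compmA.
apply: tensr_row_ext.
  rewrite -!compmA assoc1_inrl1 assoc1_inlk associator_natl.
  rewrite (reA _ (diag_inr _ _)) -!compmA /= -tens_compr assoc1_inl.
  rewrite !tens_compr (@assoc1_inrlk p (arr_tens q r) s) associator_natm.
  rewrite (reA _ (diag_inl _ _)) -compmA.
  rewrite /= (tensL3 _ (assoc1_inrl1 _ _ _)).
  by rewrite pentagon.
apply: tensrr_row_ext; rewrite -[LHS]compm1 -[RHS]compm1 -!compmA.
  rewrite (@assoc1_inrrk (arr_tens p q) r s) associator_natr assoc1_inrlk.
  rewrite (reA _ (diag_inr _ _)) -!compmA /= (tensR3 _ (assoc1_inrl1 _ _ _)).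
  rewrite (@assoc1_inrlk p (arr_tens q r) s) associator_natm.
  rewrite (reA _ (diag_inl _ _)) -!compmA /= (tensL32 _ (assoc1_inrr1 _ _ _)).
  by rewrite !compm1 pentagon.
rewrite (@assoc1_inrrk (arr_tens p q) r s) associator_natr assoc1_inrrk.
rewrite (reA _ (diag_inr _ _)) -!compmA /= (tensR32 _ (assoc1_inrr1 _ _ _)).
rewrite (@assoc1_inrrk p (arr_tens q r) s) (reA _ (diag_inr _ _)) -!compmA /=.
by rewrite !compm1 pentagon.
Qed.

Lemma arrow_inv_square (p q : arrow X) (f0 : hom (arr0 p) (arr0 q))
    (f1 : hom (arr1 p) (arr1 q)) g0 g1 :
  f1 ∘ p = q ∘ f0 -> f0 ∘ g0 = id_ _ -> g1 ∘ f1 = id_ _ -> g1 ∘ q = p ∘ g0.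
Proof.
by move=> e e0 e1; rewrite -(compm1 q) -e0 (compmA q) -e !compmA e1 comp1m.
Qed.

Definition arr_associatorV_hom p q r :
    arrow_hom (arr_tens p (arr_tens q r)) (arr_tens (arr_tens p q) r) :=
  ArrowHom (arrow_inv_square (arr_associatorP p q r)
    (associatorVK (arr0 p) (arr0 q) (arr0 r)) (arr_associatorK1 p q r)).
Definition arr_lunitorV_hom p : arrow_hom p (arr_tens arr_unit p) :=
  ArrowHom (arrow_inv_square (arr_lunitorP p)
    (lunitorVK (arr0 p)) (arr_lunitorK1 p)).
Definition arr_runitorV_hom p : arrow_hom p (arr_tens p arr_unit) :=
  ArrowHom (arrow_inv_square (arr_runitorP p)
    (runitorVK (arr0 p)) (arr_runitorK1 p)).

Definition Arr_smc : smc.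
Proof.
refine (@SMC (Arr X) arr_tens arr_tens_hom arr_unit
  arr_associator_hom arr_associatorV_hom arr_lunitor_hom arr_lunitorV_hom
  arr_runitor_hom arr_runitorV_hom arr_symm_hom
  _ _ _ _ _ _ _ _ _ _ _ _ _ _ _ _ _).
- by move=> *; apply: arrow_hom_eq; [apply: tensm1|apply: arr_tensm11].
- by move=> *; apply: arrow_hom_eq; [apply: tensmM|apply: arr_tensmM1].
- by move=> *; apply: arrow_hom_eq; [apply: associatorK|apply: arr_associatorK1].
- by move=> *; apply: arrow_hom_eq;
    [apply: associatorVK|apply: arr_associatorVK1].
- by move=> *; apply: arrow_hom_eq; [apply: lunitorK|apply: arr_lunitorK1].
- by move=> *; apply: arrow_hom_eq; [apply: lunitorVK|apply: arr_lunitorVK1].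
- by move=> *; apply: arrow_hom_eq; [apply: runitorK|apply: arr_runitorK1].
- by move=> *; apply: arrow_hom_eq; [apply: runitorVK|apply: arr_runitorVK1].
- by move=> *; apply: arrow_hom_eq; [apply: symmK|apply: arr_symmK1].
- by move=> *; apply: arrow_hom_eq;
    [apply: associator_nat|apply: arr_associator_nat1].
- by move=> *; apply: arrow_hom_eq; [apply: lunitor_nat|apply: arr_lunitor_nat1].
- by move=> *; apply: arrow_hom_eq; [apply: runitor_nat|apply: arr_runitor_nat1].
- by move=> *; apply: arrow_hom_eq; [apply: symm_nat|apply: arr_symm_nat1].
- by move=> *; apply: arrow_hom_eq; [apply: pentagon|apply: arr_pentagon1].
- by move=> *; apply: arrow_hom_eq; [apply: triangle|apply: arr_triangle1].
- by move=> *; apply: arrow_hom_eq; [apply: hexagon|apply: arr_hexagon1].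
- by move=> *; apply: arrow_hom_eq; [apply: symm_unit|apply: arr_symm_unit1].
Defined.
End ArrMonoidal.

(* Main.v *)
(* A multiplication on an arrow d : A -> M of Arr[X] is a multiplication on A
   together with a map (A ⊗ M) ⊕ (M ⊗ A) -> M. Commutativity forces the second
   entry of the latter to be the first one, alpha, precomposed with the symmetry,
   so alpha : A ⊗ M -> M determines it; the naturality square is then the Leibniz
   rule, and associativity and unitality on A ⊗ A ⊗ M and I ⊗ M are the module
   axioms. Conversely, associativity on A ⊗ M ⊗ A and M ⊗ A ⊗ A follows from the
   module axioms because A is commutative. The unit has no free component in
   degree 1, since 0 is initial. *)
From mathcomp Require Import all_boot.
From mathcomp Require Import boolp.
Require Import Defs.

Set Implicit Arguments.
Unset Strict Implicit.
Unset Printing Implicit Defensive.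
Local Open Scope cat_scope.

(** * Equality of functors through transported identities *)

Section Transport.
Variable C : category.

Definition eq_hom (A B : C) (e : A = B) : hom A B :=
  ecast B' (hom A B') e (id_ A).

(* With [e : A = A], this covers objects that are convertible but not
   syntactically equal. *)
Lemma eq_hom_refl (A : C) (e : A = A) : eq_hom e = id_ A.
Proof. by rewrite (Prop_irrelevance e erefl). Qed.

(** Naturality of [eq_hom] avoids casts between hom types. Once the object map is substituted, every
    [eq_hom] is an identity and only the maps remain to be compared. *)
Lemma functor_eq_id (F : functor C C) (e : forall A, F A = A) :
  (forall A B (f : hom A B), eq_hom (e B) ∘ fmap F f = f ∘ eq_hom (e A)) ->
  F = functor_id C.
Proof.
case: F e => fo fm f1 fM /= e; have eo : fo = (fun A => A) by apply: funext.
subst fo => H.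
have em : fm = (fun A B f => f).
  apply: functional_extensionality_dep => A.
  apply: functional_extensionality_dep => B.
  apply: funext => f.
  by move: (H A B f); rewrite !eq_hom_refl comp1m compm1.
by subst fm; rewrite /functor_id; congr Functor; apply: Prop_irrelevance.
Qed.
End Transport.

(** This and the next four lemmas move [eq_hom] to components. Round trips fix these objects up to
    conversion, so [eq_hom_refl] applies there. *)
Lemma cmhom_eq_hom (Y : smc) (A B : CMON Y) (e : A = B) :
  cmhom (eq_hom e) = eq_hom (congr1 (@cmon_obj Y) e).
Proof. by case: B / e. Qed.

Lemma ahom0_eq_hom (C : category) (p q : Arr C) (e : p = q) :
  ahom0 (eq_hom e) = eq_hom (congr1 (@arr0 C) e).
Proof. by case: q / e. Qed.

Lemma ahom1_eq_hom (C : category) (p q : Arr C) (e : p = q) :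
  ahom1 (eq_hom e) = eq_hom (congr1 (@arr1 C) e).
Proof. by case: q / e. Qed.

Lemma dhom_mon_eq_hom (X : additive_smc) (D D' : DER X) (e : D = D') :
  dhom_mon (eq_hom e) = eq_hom (congr1 (fun K => cmon_obj (der_mon K)) e).
Proof. by case: D' / e. Qed.

Lemma dhom_mod_eq_hom (X : additive_smc) (D D' : DER X) (e : D = D') :
  dhom_mod (eq_hom e) = eq_hom (congr1 (fun K => mod_obj (der_mod K)) e).
Proof. by case: D' / e. Qed.

Lemma cmonoid_eq (Y : smc) (A : Y) (m m' : hom (A ⊗ A) A) (u u' : hom munit A)
    a a' b b' c c' d d' :
  m = m' -> u = u' ->
  @CMonoid Y A m u a b c d = @CMonoid Y A m' u' a' b' c' d'.
Proof. by move=> em eu; subst m' u'; congr CMonoid; apply: Prop_irrelevance. Qed.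

(** Among the data only the action differs after a round trip; sharing the rest avoids dependent
    casts. *)
Lemma derivation_eq (X : additive_smc) (A M : X) (m : hom (A ⊗ A) A)
    (u : hom munit A) (t t' : hom (A ⊗ M) M) (d : hom A M)
    a a' b b' c c' k k' v v' w w' x x' y y' :
  t = t' ->
  @Derivation X (@CMonoid X A m u a b c k)
    (@AModule X (@CMonoid X A m u a b c k) M t v w) d x y =
  @Derivation X (@CMonoid X A m u a' b' c' k')
    (@AModule X (@CMonoid X A m u a' b' c' k') M t' v' w') d x' y'.
Proof.
move=> et; subst t'.
have e := Prop_irrelevance a a'; subst a'.
have e := Prop_irrelevance b b'; subst b'.
have e := Prop_irrelevance c c'; subst c'.
have e := Prop_irrelevance k k'; subst k'.
have e := Prop_irrelevance v v'; subst v'.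
have e := Prop_irrelevance w w'; subst w'.
by congr Derivation; apply: Prop_irrelevance.
Qed.

Lemma split_epi (C : category) (A B K : C) (f g : hom B K) (h : hom A B)
    (k : hom B A) :
  h ∘ k = id_ B -> f ∘ h = g ∘ h -> f = g.
Proof. by move=> hk e; rewrite -(compm1 f) -(compm1 g) -hk !compmA e. Qed.

(** * The right action induced by the symmetry *)

Section ModuleSymmetry.
Variables (X : smc) (A : cmonoid X) (M : amodule A).
Local Notation a := (mact M).
Local Notation b := (mact M ∘ symm M A).

(* On elements [(y ⊗ m) ⊗ x] this reads [x (y m) = y (x m)]. *)
Lemma mact_swap :
  a ∘ (id_ A ⊗m a) ∘ symm (A ⊗ M) A =
  a ∘ (id_ A ⊗m b) ∘ associator A M A.
Proof.
rewrite -[X in X ⊗m b](comp1m (id_ A)) tensmM (compmA a).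
set L := a ∘ (id_ A ⊗m a).
(* Elementwise, [(x y) m = (y x) m]. *)
have Lswap : L ∘ associator A A M ∘ (symm A A ⊗m id_ M) = L ∘ associator A A M.
  by rewrite -mactA -compmA -tensmM comp1m cmulC.
(* Precomposing with these two isomorphisms exposes one side of the hexagon; the leftover [symm A A]
   is absorbed by [Lswap]. *)
apply: (split_epi (symmK (A ⊗ M) A)).
apply: (split_epi (associatorVK A A M)).
rewrite -(compmA L) symmK compm1 -!compmA hexagon !compmA.
by rewrite -(compmA L) -tensmM symmK comp1m tensm1 compm1 Lswap.
Qed.

Lemma right_action_mact :
  b ∘ (a ⊗m id_ A) = a ∘ (id_ A ⊗m b) ∘ associator A M A.
Proof. by rewrite -compmA symm_nat compmA mact_swap. Qed.

(** On [(m ⊗ x) ⊗ y] this reads [y (x m) = (x y) m]: the left side becomes [x (y m)] by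
    [right_action_mact], and the hexagon reduces the rest to [mactA]. *)
Lemma right_action_mul :
  b ∘ (b ⊗m id_ A) = b ∘ (id_ M ⊗m cmul A) ∘ associator M A A.
Proof.
rewrite -[X in _ ⊗m X](comp1m (id_ A)) tensmM (compmA b) right_action_mact.
rewrite -[b ∘ (id_ M ⊗m cmul A)]compmA symm_nat (compmA a) mactA -!compmA hexagon.
by rewrite -{1}(comp1m (id_ A)) tensmM !compmA.
Qed.

Lemma right_action_one : b ∘ (id_ M ⊗m cone A) = runitor M.
Proof. by rewrite -compmA symm_nat compmA mact1 symm_unit. Qed.
End ModuleSymmetry.

(** * From commutative monoids of arrows to derivations *)

Section CMonToDer.
Variables (X : additive_smc) (bX : finite_biproducts X).
Local Notation i1 := (inl_ bX _ _).
Local Notation i2 := (inr_ bX _ _).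

Section Obj.
Variable P : cmonoid (Arr_smc bX).
Let p : arrow X := cmon_obj P.
Let m : arrow_hom (arr_tens bX p p) p := cmul P.
Let u : arrow_hom (arr_unit bX) p := cone P.

Definition dom_cmonoid : cmonoid X.
Proof.
refine (@CMonoid X (arr0 p) (ahom0 m) (ahom0 u) _ _ _ _).
- exact (congr1 (@ahom0 _ _ _) (cmulA P)).
- exact (congr1 (@ahom0 _ _ _) (cmul1m P)).
- exact (congr1 (@ahom0 _ _ _) (cmulm1 P)).
- exact (congr1 (@ahom0 _ _ _) (cmulC P)).
Defined.

Lemma ahom1_cmul_inr : ahom1 m ∘ i2 = ahom1 m ∘ i1 ∘ symm (arr1 p) (arr0 p).
Proof.
have /(congr1 (fun f => f ∘ i2)) := congr1 (@ahom1 _ _ _) (cmulC P).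
by rewrite /= -compmA anti_inr compmA => <-.
Qed.

Definition cod_module : amodule dom_cmonoid.
Proof.
refine (@AModule X dom_cmonoid (arr1 p) (ahom1 m ∘ i1) _ _).
(* Associativity in degree 1, on the summand [(arr0 p ⊗ arr0 p) ⊗ arr1 p]. *)
- have /(congr1 (fun f => f ∘ i1)) := congr1 (@ahom1 _ _ _) (cmulA P).
  rewrite /= -!compmA diag_inl => ->.
  rewrite -/m assoc1_inl (reA _ (diag_inl _ _ _)).
  rewrite -!compmA (compmA (_ ⊗m _) (_ ⊗m _)) -tensmM compm1.
  by rewrite !compmA.
- have /(congr1 (fun f => f ∘ i1)) := congr1 (@ahom1 _ _ _) (cmul1m P).
  by rewrite /= -!compmA diag_inl row_inl => ->.
Defined.

Definition arrow_derivation : derivation X.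
Proof.
refine (@Derivation X dom_cmonoid cod_module p _ _).
(* The square of [u] starts with the zero map [arr_unit], so [p] kills the unit. *)
- by have /= := ahomP u; rewrite compm0.
- have /= := ahomP m; rewrite comp_bcol => <-.
  by rewrite ahom1_cmul_inr compmDr !compmA.
Defined.
End Obj.

Definition arrow_derivation_hom (P Q : cmonoid (Arr_smc bX))
  (f : cmonoid_hom P Q) : derivation_hom (arrow_derivation P) (arrow_derivation Q).
Proof.
refine (@DerivationHom X (arrow_derivation P) (arrow_derivation Q)
  (ahom0 (cmhom f)) (ahom1 (cmhom f)) _ _ _).
- have [fM f1] := cmhomP f.
  by split; [exact (congr1 (@ahom0 _ _ _) fM)|exact (congr1 (@ahom0 _ _ _) f1)].
- have [fM _] := cmhomP f.
  (* Multiplicativity in degree 1, on the summand where both multiplications are the actions. *)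
  have /(congr1 (fun f => f ∘ i1)) := congr1 (@ahom1 _ _ _) fM.
  by rewrite /= -!compmA diag_inl.
- exact: ahomP (cmhom f).
Defined.

Definition CMON_to_DER : functor (CMON (Arr_smc bX)) (DER X).
Proof.
by refine (@Functor (CMON (Arr_smc bX)) (DER X) arrow_derivation
  arrow_derivation_hom _ _); move=> *; apply: derivation_hom_eq.
Defined.
End CMonToDer.

(** * From derivations to commutative monoids of arrows *)

Section DerToCMon.
Variables (X : additive_smc) (bX : finite_biproducts X).
Local Notation i1 := (inl_ bX _ _).
Local Notation i2 := (inr_ bX _ _).

Section Obj.
Variable D : derivation X.
Local Notation A := (der_mon D).
Local Notation M := (der_mod D).

Definition derivation_arrow : arrow X := Arrow (der D).

Definition derivation_mul :
  arrow_hom (arr_tens bX derivation_arrow derivation_arrow) derivation_arrow.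
Proof.
refine (@ArrowHom X (arr_tens bX derivation_arrow derivation_arrow)
  derivation_arrow (cmul A) (brow bX (mact M) (mact M ∘ symm M A)) _).
by rewrite /= row_col der_mul compmDr !compmA.
Defined.

Definition derivation_unit : arrow_hom (arr_unit bX) derivation_arrow.
Proof.
by refine (@ArrowHom X (arr_unit bX) derivation_arrow (cone A) 0 _);
  rewrite compm0 /= der_one.
Defined.

Definition derivation_cmonoid : cmonoid (Arr_smc bX).
Proof.
refine (@CMonoid (Arr_smc bX) derivation_arrow derivation_mul derivation_unit
  _ _ _ _); apply: arrow_hom_eq.
(* Each law splits into degree 0, inherited from [A], and degree 1, checked on summands of the
   domain. *)
- exact: cmulA.
- set d := derivation_arrow; apply: row_ext; rewrite /= -!compmA.
    rewrite diag_inl (assoc1_inl bX d d d) (reA _ (diag_inl _ _ _)).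
    rewrite (compmA (brow _ _ _)) row_inl.
    rewrite (compmA (brow _ _ _)) (compmA (brow _ _ _)) row_inl mactA.
    by rewrite -!compmA (compmA (_ ⊗m _) (_ ⊗m _)) -tensmM compm1 row_inl.
  (* There remain [(A ⊗ M) ⊗ A] and [(M ⊗ A) ⊗ A], where the right action enters. *)
  apply: tensr_row_ext; rewrite -!compmA.
    rewrite (assoc1_inrl1 bX d d d) (reA _ (diag_inl _ _ _)) /=.
    rewrite (reA _ (diag_inr _ _ _)) /=.
    rewrite !(compmA (brow _ _ _)) row_inl row_inr.
    rewrite -!compmA -tensmM compm1 row_inl compmA right_action_mact.
    by rewrite -!compmA (compmA (_ ⊗m _) (_ ⊗m _)) -tensmM compm1 row_inr.
  rewrite (assoc1_inrr1 bX d d d) !(reA _ (diag_inr _ _ _)) /=.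
  rewrite !(compmA (brow _ _ _)) row_inr.
  rewrite -(compmA (_ ∘ _) (_ ⊗m _)) -tensmM compm1 row_inr.
  exact: right_action_mul.
- exact: cmul1m.
(* The second summand is [zero_obj bX ⊗ A], a zero object. *)
- apply: row_ext; last exact: zero_tensl_ext.
  by rewrite /= -compmA diag_inl compmA !row_inl mact1.
- exact: cmulm1.
- apply: row_ext; first exact: zero_tensr_ext.
  by rewrite /= -compmA diag_inr compmA !row_inr right_action_one.
- exact: cmulC.
- apply: row_ext; rewrite /= -compmA.
    by rewrite anti_inl compmA row_inr row_inl -compmA symmK compm1.
  by rewrite anti_inr compmA row_inr row_inl.
Defined.
End Obj.

Definition derivation_cmonoid_hom (D E : derivation X) (f : derivation_hom D E) :
  cmonoid_hom (derivation_cmonoid D) (derivation_cmonoid E).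
Proof.
refine (@CMonoidHom _ (derivation_cmonoid D) (derivation_cmonoid E)
  (@ArrowHom X (derivation_arrow D) (derivation_arrow E) (dhom_mon f)
     (dhom_mod f) (dhom_der f)) _).
have [fM f1] := dhom_monP f.
split; apply: arrow_hom_eq => //=; last exact: zero_obj_initial.
apply: row_ext; rewrite -!compmA.
  by rewrite row_inl diag_inl compmA row_inl dhom_act.
(* On [M ⊗ A], naturality of the symmetry reduces to the left action. *)
rewrite row_inr diag_inr !compmA row_inr dhom_act -!compmA.
by rewrite symm_nat.
Defined.

Definition DER_to_CMON : functor (DER X) (CMON (Arr_smc bX)).
Proof.
by refine (@Functor (DER X) (CMON (Arr_smc bX)) derivation_cmonoid
  derivation_cmonoid_hom _ _);
  move=> *; apply: cmonoid_hom_eq; apply: arrow_hom_eq.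
Defined.
End DerToCMon.

(** * The two functors are mutually inverse *)

Lemma arrow_derivationK (X : additive_smc) (bX : finite_biproducts X)
    (P : cmonoid (Arr_smc bX)) :
  derivation_cmonoid bX (arrow_derivation P) = P.
Proof.
(* The rebuilt multiplication keeps only the first entry in degree 1; commutativity recovers the
   second. *)
have := ahom1_cmul_inr P.
case: P => -[A M d] m u PA P1 P1' PC /= mC.
apply: cmonoid_eq; apply: arrow_hom_eq => //=; last exact: zero_obj_initial.
by apply: row_ext; rewrite ?row_inl ?row_inr.
Qed.

Lemma derivation_cmonoidK (X : additive_smc) (bX : finite_biproducts X)
    (D : derivation X) :
  arrow_derivation (derivation_cmonoid bX D) = D.
Proof.
case: D => -[A m u mA m1 m1' mC] [M t tA t1] d d1 dM.
(* The recovered action is the first entry of a row, equal to [t] only propositionally. *)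
by apply: derivation_eq; rewrite /= row_inl.
Qed.

Theorem proposition6p3 (X : additive_smc) (bX : finite_biproducts X) :
  isomorphic_categories (CMON (Arr_smc bX)) (DER X).
Proof.
exists (CMON_to_DER bX), (DER_to_CMON bX); split.
- apply: (@functor_eq_id _ (functor_comp (DER_to_CMON bX) (CMON_to_DER bX))
    (@arrow_derivationK X bX)).
  (* The round trip leaves the components of [f] unchanged; only the transports have to be
     removed. *)
  move=> P Q f; apply: cmonoid_hom_eq; apply: arrow_hom_eq => /=.
    by rewrite !cmhom_eq_hom !ahom0_eq_hom !eq_hom_refl comp1m compm1.
  by rewrite !cmhom_eq_hom !ahom1_eq_hom !eq_hom_refl comp1m compm1.
- apply: (@functor_eq_id _ (functor_comp (CMON_to_DER bX) (DER_to_CMON bX))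
    (@derivation_cmonoidK X bX)).
  move=> D E f; apply: derivation_hom_eq => /=.
    by rewrite !dhom_mon_eq_hom !eq_hom_refl comp1m compm1.
  by rewrite !dhom_mod_eq_hom !eq_hom_refl comp1m compm1.
Qed.
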